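(* Let $m,n\in\mathbb{N}$. i) The number $c(m,n)$ of cyclic subgroups of $\mathbb{Z}_m\times\mathbb{Z}_n$ is given by $$c(m,n)=\sum_{\substack{a\mid m,\ b\mid n\\ \gcd(m/a,n/b)=1}}\gcd(a,b)=\sum_{a\mid m,\ b\mid n}\phi(\gcd(a,b))=\sum_{d\mid\gcd(m,n)}(\mu*\phi)(d)\,\tau(m/d)\,\tau(n/d)=\sum_{d\mid\gcd(m,n)}\phi(d)\,\tau(mn/d^2).$$ ii) The number of subproducts of $\mathbb{Z}_m\times\mathbb{Z}_n$ is $\tau(m)\tau(n)$, and the number of its cyclic subproducts is $\tau(mn)$.
   Context: $\mathbb{N}=\{1,2,\ldots\}$. $\mathbb{Z}_m$ denotes the additive group of residue classes modulo $m$. $\tau(n)$ is the number of positive divisors of $n$, $\phi$ is Euler's totient function, $\mu$ is the Möbius function, and $*$ denotes Dirichlet convolution, $(f*g)(n)=\sum_{d\mid n}f(d)g(n/d)$. All divisors in the sums are positive. A subgroup $H$ of $\mathbb{Z}_m\times\mathbb{Z}_n$ is called a subproduct if $H=H_1\times H_2$ where $H_1$ is a subgroup of $\mathbb{Z}_m$ and $H_2$ is a subgroup of $\mathbb{Z}_n$. *)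

(* Defs.v *)
From mathcomp Require Import all_boot all_order all_algebra all_fingroup all_solvable.

Set Implicit Arguments.
Unset Strict Implicit.
Unset Printing Implicit Defensive.

Import GRing.Theory.

(* Arithmetic functions are maps nat -> R whose value at 0 is irrelevant. *)

Definition tau (n : nat) : nat := size (divisors n).

(* An n > 0 is squarefree iff every prime of [primes n] has exponent 1. *)
Definition mobius (n : nat) : int :=
  if all (fun p => logn p n == 1%N) (primes n)
  then ((-1) ^+ size (primes n))%R else 0%R.

Definition dirichlet (R : pzSemiRingType) (f g : nat -> R) (n : nat) : R :=
  (\sum_(d <- divisors n) f d * g (n %/ d)%N)%R.

(* The type 'Z_1 has two elements, whereas the subgroup [Zp m] of 'Z_m has
   exactly m elements for every m > 0, including m = 1; hence Z_m is [Zp m].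
   The group law that 'Z_m carries as a finGroupType is addition modulo m. *)
Definition Zprod (m n : nat) : {set 'Z_m * 'Z_n} := setX (Zp m) (Zp n).

Definition is_subproduct (m n : nat) (H : {group 'Z_m * 'Z_n}) : bool :=
  [exists H1 in subgroups (Zp m), exists H2 in subgroups (Zp n),
     H == setX H1 H2 :> {set _}].

Definition cyclic_subgroups (m n : nat) : {set {group 'Z_m * 'Z_n}} :=
  [set H in subgroups (Zprod m n) | cyclic H].

Definition subproducts (m n : nat) : {set {group 'Z_m * 'Z_n}} :=
  [set H in subgroups (Zprod m n) | is_subproduct H].

Definition cyclic_subproducts (m n : nat) : {set {group 'Z_m * 'Z_n}} :=
  [set H in subproducts m n | cyclic H].

(* Main.v *)
Require Import Defs.
From mathcomp Require Import all_boot all_order all_algebra all_fingroup all_solvable.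

(** The proof rests on a weighted count.  In a finite group every cyclic subgroup
    [H] has [phi(|H|)] generators, so giving each element [z] the weight
    [1 / phi(#[z])] makes the total weight of the group equal to its number of
    cyclic subgroups ([sum_order_cyclic_subgroups]).  In a product of two cyclic
    groups of orders [m] and [n], the element [(x, y)] has order
    [lcm(#[x], #[y])] ([order_pair]), and there are [phi(a) phi(b)] pairs with
    [#[x] = a] and [#[y] = b] for all [a | m] and [b | n].  Since
    [phi(a) phi(b) = phi(gcd(a, b)) phi(lcm(a, b))] ([totient_gcd_lcm]), these
    pairs have total weight [phi(gcd(a, b))].  This is the second formula.

    The other formulas follow by manipulating divisor sums.
    - Sorting the pairs [(a, b)] by [d = gcd(a, b)] leaves, for each [d], the
      coprime pairs of divisors of [m/d] and [n/d]; there are [tau(mn/d^2)] of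
      them ([sum_coprime_divisors]), through the bijection
      [(a, b) |-> (m/a) b] from coprime pairs to divisors of [mn].  This is the
      fourth formula.
    - Writing [gcd(a, b)] as the sum of [phi(d)] over its divisors and exchanging
      the sums turns the first formula into the fourth.
    - Writing [phi(gcd(a, b))] as the sum of [(mu * phi)(d)] over the divisors [d]
      of [gcd(a, b)] (Moebius inversion, [sum_dirichlet_mobius]) and exchanging
      the sums turns the second formula into the third.

    For the subproducts, [(H1, H2) |-> H1 x H2] is injective, a cyclic group of
    order [m] has one subgroup for each divisor of [m], and [H1 x H2] is cyclic
    exactly when [|H1|] and [|H2|] are coprime ([cyclic_setX]); the cyclic
    subproducts are thus counted by the same coprime pairs of divisors. *)

Set Implicit Arguments.
Unset Strict Implicit.
Unset Printing Implicit Defensive.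

(** * Sums over divisors *)

Section DivisorSums.

Variables (R : Type) (idx : R) (op : Monoid.com_law idx).

Lemma big_divisors_multiple d m (F : nat -> R) : 0 < m -> d %| m ->
  \big[op/idx]_(a <- divisors m | d %| a) F a =
  \big[op/idx]_(a <- divisors (m %/ d)) F (d * a).
Proof.
move=> m_gt0 dv_m; have d_gt0 := dvdn_gt0 m_gt0 dv_m.
have q_gt0: 0 < m %/ d by rewrite divn_gt0 // dvdn_leq.
rewrite -big_filter -(big_map (muln d) xpredT F); apply: perm_big.
apply: uniq_perm => [||a].
- by rewrite filter_uniq ?divisors_uniq.
- by rewrite map_inj_uniq ?divisors_uniq // => x y /eqP; rewrite eqn_pmul2l // => /eqP.
rewrite mem_filter -dvdn_divisors //; apply/andP/mapP => [[] | [b]].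
  case/dvdnP=> b ->; rewrite mulnC => dv_ab; exists b => //.
  by rewrite -dvdn_divisors // dvdn_divRL // mulnC.
by rewrite -dvdn_divisors // dvdn_divRL // mulnC => dv_b ->; rewrite dvdn_mulr.
Qed.

Lemma big_divisors_sub k m (F : nat -> R) : 0 < m -> k %| m ->
  \big[op/idx]_(d <- divisors k) F d =
  \big[op/idx]_(d <- divisors m | d %| k) F d.
Proof.
move=> m_gt0 dv_k; have k_gt0 := dvdn_gt0 m_gt0 dv_k.
rewrite -[RHS]big_filter; apply: perm_big; apply: uniq_perm => [||d].
- exact: divisors_uniq.
- by rewrite filter_uniq ?divisors_uniq.
rewrite mem_filter -!dvdn_divisors //.
by case dv_d: (d %| k); rewrite // (dvdn_trans dv_d).
Qed.

(** Triples [d | gcd(a, b)], [a | m], [b | n], with [d] summed first; [a] and [b]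
    are then written as multiples of [d]. *)
Lemma exchange_divisors_common m n (F : nat -> nat -> nat -> R) : 0 < m -> 0 < n ->
  \big[op/idx]_(a <- divisors m) \big[op/idx]_(b <- divisors n)
     \big[op/idx]_(d <- divisors (gcdn a b)) F d a b =
  \big[op/idx]_(d <- divisors (gcdn m n))
     \big[op/idx]_(a <- divisors (m %/ d)) \big[op/idx]_(b <- divisors (n %/ d))
        F d (d * a) (d * b).
Proof.
move=> m_gt0 n_gt0.
have g_gt0: 0 < gcdn m n by rewrite gcdn_gt0 m_gt0.
transitivity (\big[op/idx]_(a <- divisors m) \big[op/idx]_(b <- divisors n)
   \big[op/idx]_(d <- divisors (gcdn m n) | (d %| a) && (d %| b)) F d a b).
  apply: eq_big_seq => a; rewrite -dvdn_divisors // => dv_a.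
  apply: eq_big_seq => b; rewrite -dvdn_divisors // => dv_b.
  have dv_g: gcdn a b %| gcdn m n.
    by rewrite dvdn_gcd (dvdn_trans (dvdn_gcdl a b)) ?(dvdn_trans (dvdn_gcdr a b)).
  rewrite (big_divisors_sub _ g_gt0 dv_g).
  by apply: eq_bigl => d; rewrite dvdn_gcd.
transitivity (\big[op/idx]_(d <- divisors (gcdn m n)) \big[op/idx]_(a <- divisors m | d %| a)
   \big[op/idx]_(b <- divisors n | d %| b) F d a b).
  under eq_bigr do rewrite (exchange_big_dep xpredT) //=.
  rewrite exchange_big /=; apply: eq_bigr => d _.
  rewrite [RHS]big_mkcond /=; apply: eq_bigr => a _.
  case: ifP => _ //=; last by rewrite big_pred0.
apply: eq_big_seq => d; rewrite -dvdn_divisors // dvdn_gcd => /andP[dv_m dv_n].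
rewrite big_divisors_multiple //; apply: eq_bigr => a _.
by rewrite big_divisors_multiple.
Qed.

(** Pairs of divisors sorted by their greatest common divisor. *)
Lemma big_divisors_gcd m n (F : nat -> nat -> R) : 0 < m -> 0 < n ->
  \big[op/idx]_(a <- divisors m) \big[op/idx]_(b <- divisors n) F a b =
  \big[op/idx]_(d <- divisors (gcdn m n))
     \big[op/idx]_(a <- divisors (m %/ d))
     \big[op/idx]_(b <- divisors (n %/ d) | coprime a b) F (d * a) (d * b).
Proof.
move=> m_gt0 n_gt0.
transitivity (\big[op/idx]_(a <- divisors m) \big[op/idx]_(b <- divisors n)
   \big[op/idx]_(d <- divisors (gcdn a b)) if d == gcdn a b then F a b else idx).
  apply: eq_big_seq => a; rewrite -dvdn_divisors // => /(dvdn_gt0 m_gt0) a_gt0.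
  apply: eq_big_seq => b; rewrite -dvdn_divisors // => /(dvdn_gt0 n_gt0) b_gt0.
  rewrite (bigD1_seq (gcdn a b)) ?divisors_uniq ?divisors_id ?gcdn_gt0 ?a_gt0 //=.
  by rewrite eqxx big1 ?Monoid.mulm1 // => d /negbTE->.
rewrite (exchange_divisors_common (fun d a b => if d == gcdn a b then F a b else idx)) //.
apply: eq_big_seq => d; rewrite -dvdn_divisors ?gcdn_gt0 ?m_gt0 // => dv_d.
have d_gt0: 0 < d by apply: dvdn_gt0 dv_d; rewrite gcdn_gt0 m_gt0.
apply: eq_bigr => a _; rewrite [RHS]big_mkcond; apply: eq_bigr => b _.
by rewrite -muln_gcdr -{1}[d]muln1 eqn_pmul2l // eq_sym.
Qed.

Lemma big_divisors_compl m (F : nat -> R) : 0 < m ->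
  \big[op/idx]_(a <- divisors m) F (m %/ a) = \big[op/idx]_(a <- divisors m) F a.
Proof.
move=> m_gt0; rewrite -(big_map (divn m) xpredT F); apply: perm_big.
have divK a: a %| m -> m %/ (m %/ a) = a.
  by move=> dv_a; rewrite divnA // mulnC mulnK.
apply: uniq_perm => [||a]; rewrite ?divisors_uniq //.
  rewrite map_inj_in_uniq ?divisors_uniq // => a b.
  by rewrite -!dvdn_divisors // => /divK{2}<- /divK{2}<- ->.
rewrite -dvdn_divisors //; apply/mapP/idP=> [[b]|dv_a].
  by rewrite -dvdn_divisors // => dv_b ->; rewrite dvdn_div.
by exists (m %/ a); rewrite ?divK // -dvdn_divisors // dvdn_div.
Qed.

End DivisorSums.

Lemma exchange_divisors (R : Type) (idx : R) (op : Monoid.com_law idx)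
    n (F : nat -> nat -> R) : 0 < n ->
  \big[op/idx]_(d <- divisors n) \big[op/idx]_(e <- divisors d) F d e =
  \big[op/idx]_(e <- divisors n) \big[op/idx]_(k <- divisors (n %/ e)) F (e * k) e.
Proof.
move=> n_gt0.
transitivity (\big[op/idx]_(d <- divisors n) \big[op/idx]_(e <- divisors n | e %| d) F d e).
  apply: eq_big_seq => d; rewrite -dvdn_divisors // => dv_d.
  by rewrite (big_divisors_sub _ _ n_gt0 dv_d).
rewrite (exchange_big_dep xpredT) //; apply: eq_big_seq => e.
by rewrite -dvdn_divisors // => dv_e; rewrite big_divisors_multiple.
Qed.

Lemma divn_dvd_gt0 d m : 0 < m -> d %| m -> 0 < m %/ d.
Proof. by move=> m_gt0 dv_m; rewrite divn_gt0 ?(dvdn_gt0 m_gt0) // dvdn_leq. Qed.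

Lemma mul_divn_sqr m n d : d %| m -> d %| n ->
  (m * n) %/ d ^ 2 = (m %/ d) * (n %/ d).
Proof. by move=> dv_m dv_n; rewrite -mulnn divnMA -divn_mulAC // muln_divA. Qed.

Lemma tau_sum n : tau n = \sum_(d <- divisors n) 1.
Proof. by rewrite big_const_seq count_predT iter_addn mul1n addn0. Qed.

(** The coprime pairs [(a, b)] with [a | m] and [b | n] are in bijection with the
    divisors of [m * n] through [f (a, b) = (m / a) * b].  The inverse sends [d] to
    [(m / g, d / g)] with [g = gcd(d, m)], because coprimality of [a] and [b] gives
    [gcd(f (a, b), m) = (m / a) * gcd(b, a) = m / a]. *)
Lemma sum_coprime_divisors m n : 0 < m -> 0 < n ->
  \sum_(a <- divisors m) \sum_(b <- divisors n | coprime a b) 1 = tau (m * n).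
Proof.
move=> m_gt0 n_gt0; have mn_gt0: 0 < m * n by rewrite muln_gt0 m_gt0.
pose s := [seq u <- [seq (a, b) | a <- divisors m, b <- divisors n] | coprime u.1 u.2].
transitivity (size s).
  rewrite -sum1_size big_filter [RHS]big_mkcond big_allpairs.
  by apply: eq_bigr => a _; rewrite [LHS]big_mkcond.
pose f u := m %/ u.1 * u.2.
have memE u: u \in s = [&& u.1 %| m, u.2 %| n & coprime u.1 u.2].
  rewrite mem_filter andbC andbA; congr (_ && _).
  case: u => a b; apply/allpairsP/andP => /= [[[x y] /= [xm yn [-> ->]]]|[dv_a dv_b]].
    by rewrite !dvdn_divisors.
  by exists (a, b); rewrite -!dvdn_divisors.
have fgcd u: u \in s -> gcdn (f u) m = m %/ u.1.
  rewrite memE => /and3P[dv_a _ co]; rewrite /f -{2}(divnK dv_a) -muln_gcdr.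
  by rewrite gcdnC (eqnP co) muln1.
have div_fgcd u: u \in s -> (m %/ gcdn (f u) m, f u %/ gcdn (f u) m) = u.
  move=> su; rewrite fgcd //; move: su; rewrite memE => /and3P[dv_a _ _].
  have a_gt0: 0 < u.1 := dvdn_gt0 m_gt0 dv_a.
  have q_gt0: 0 < m %/ u.1 by rewrite divn_gt0 // dvdn_leq.
  by rewrite /f mulKn // divnA // mulKn //; case: (u).
have <-: size (map f s) = size s by rewrite size_map.
apply: perm_size; apply: uniq_perm => [||d]; rewrite ?divisors_uniq //.
  rewrite map_inj_in_uniq => [|u v su sv eqf].
    rewrite filter_uniq // allpairs_uniq ?divisors_uniq // => [[a b] [c d]] _ _ /= [-> ->] //.
  by rewrite -(div_fgcd u) // eqf div_fgcd.
rewrite -dvdn_divisors //; apply/mapP/idP=> [[u su ->]|dv_d].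
  move: su; rewrite memE => /and3P[dv_a dv_b _].
  by rewrite dvdn_mul ?dvdn_div.
have d_gt0 := dvdn_gt0 mn_gt0 dv_d.
set g := gcdn d m; have g_gt0: 0 < g by rewrite gcdn_gt0 d_gt0.
have gd: g %| d := dvdn_gcdl _ _; have gm: g %| m := dvdn_gcdr _ _.
exists (m %/ g, d %/ g); last by rewrite /f /= divnA // mulKn // mulnC divnK.
have co: coprime (m %/ g) (d %/ g).
  by rewrite /coprime -(eqn_pmul2r g_gt0) muln_gcdl !divnK // gcdnC mul1n.
rewrite memE /= co dvdn_div // andbT /=.
(* [d / g] is coprime to [m / g] and divides [(m / g) * n], so it divides [n]. *)
rewrite -(@Gauss_dvdr _ (m %/ g)); last by rewrite coprime_sym.
by rewrite -(dvdn_pmul2r g_gt0) mulnAC !divnK.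
Qed.

(** * Euler's totient function *)

Lemma sum_totient_divisors n : 0 < n -> \sum_(d <- divisors n) totient d = n.
Proof.
move=> n_gt0; rewrite -[RHS]sum_totient_dvd -(big_mkord (dvdn^~ n)) -[RHS]big_filter.
apply: perm_big; apply: uniq_perm => [||d].
- exact: divisors_uniq.
- by rewrite filter_uniq ?iota_uniq.
rewrite mem_filter -dvdn_divisors // mem_index_iota ltnS /=.
by case dv_d: (d %| n); rewrite // dvdn_leq.
Qed.

(** Multiplicativity of the totient, as a product over the primes of any multiple
    [N] of [n]: this puts the totients of several divisors of [N] on a common index
    set. *)
Lemma totient_prod_pfactor N n : 0 < N -> n %| N ->
  totient n = \prod_(p <- primes N) totient (p ^ logn p n).
Proof.
move=> N_gt0 dv_n; have n_gt0 := dvdn_gt0 N_gt0 dv_n.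
rewrite [RHS](bigID (mem (primes n))) /= [X in _ = _ * X]big1 ?muln1; last first.
  by move=> p; rewrite -logn_gt0 -eqn0Ngt => /eqP->.
rewrite totientE // -[RHS]big_filter.
have ->: \prod_(p <- primes n) (p.-1 * p ^ (logn p n).-1) =
         \prod_(p <- primes n) totient (p ^ logn p n).
  apply: eq_big_seq => p; rewrite -logn_gt0 => p_n; rewrite totient_pfactor //.
  by move: p_n; rewrite logn_gt0 mem_primes; case/and3P.
apply: perm_big; apply: uniq_perm => [||p]; rewrite ?filter_uniq ?primes_uniq //.
rewrite mem_filter; case p_n: (p \in primes n) => //=.
move: p_n; rewrite !mem_primes => /and3P[-> _ dv_p].
by rewrite N_gt0 (dvdn_trans dv_p).
Qed.

(** Prime by prime, [gcd] and [lcm] take the minimum and the maximum of the two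
    exponents. *)
Lemma totient_gcd_lcm a b : 0 < a -> 0 < b ->
  totient (gcdn a b) * totient (lcmn a b) = totient a * totient b.
Proof.
move=> a_gt0 b_gt0; have N_gt0: 0 < a * b by rewrite muln_gt0 a_gt0.
have dv_l: lcmn a b %| a * b by rewrite dvdn_lcm dvdn_mulr ?dvdn_mull.
have dv_g: gcdn a b %| a * b by rewrite dvdn_mulr ?dvdn_gcdl.
have [dv_a dv_b]: a %| a * b /\ b %| a * b by rewrite dvdn_mulr ?dvdn_mull.
rewrite !(totient_prod_pfactor N_gt0 dv_g, totient_prod_pfactor N_gt0 dv_l).
rewrite !(totient_prod_pfactor N_gt0 dv_a, totient_prod_pfactor N_gt0 dv_b) -!big_split.
apply: eq_bigr => p _ /=; rewrite logn_gcd // logn_lcm //.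
by case: leqP; rewrite // mulnC.
Qed.

Lemma sum_gcd_totient m n : 0 < m -> 0 < n ->
  \sum_(a <- divisors m) \sum_(b <- divisors n) totient (gcdn a b) =
  \sum_(d <- divisors (gcdn m n)) totient d * tau ((m * n) %/ d ^ 2).
Proof.
move=> m_gt0 n_gt0.
rewrite (@big_divisors_gcd _ _ _ m n (fun a b => totient (gcdn a b))) //.
apply: eq_big_seq => d; rewrite -dvdn_divisors ?gcdn_gt0 ?m_gt0 // dvdn_gcd.
case/andP=> dv_m dv_n; have d_gt0 := dvdn_gt0 m_gt0 dv_m.
have [m'_gt0 n'_gt0]: 0 < m %/ d /\ 0 < n %/ d by rewrite !divn_dvd_gt0.
rewrite mul_divn_sqr // -sum_coprime_divisors // !big_distrr /=.
apply: eq_bigr => a _; rewrite big_distrr; apply: eq_bigr => b /eqnP co.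
by rewrite /= -muln_gcdr co !muln1.
Qed.

Lemma sum_coprime_gcd m n : 0 < m -> 0 < n ->
  \sum_(a <- divisors m) \sum_(b <- divisors n | gcdn (m %/ a) (n %/ b) == 1) gcdn a b =
  \sum_(d <- divisors (gcdn m n)) totient d * tau ((m * n) %/ d ^ 2).
Proof.
move=> m_gt0 n_gt0.
(* The condition on the complementary divisors goes into the summand, so that
   [gcdn a b] can be expanded as a sum of totients over all pairs. *)
pose F d a b := if coprime (m %/ a) (n %/ b) then totient d else 0.
transitivity (\sum_(a <- divisors m) \sum_(b <- divisors n) \sum_(d <- divisors (gcdn a b)) F d a b).
  apply: eq_big_seq => a; rewrite -dvdn_divisors // => /(dvdn_gt0 m_gt0) a_gt0.
  rewrite big_mkcond /=; apply: eq_bigr => b _; rewrite /F /coprime.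
  case: ifP => _; last by rewrite big1.
  by rewrite sum_totient_divisors // gcdn_gt0 a_gt0.
rewrite exchange_divisors_common //.
apply: eq_big_seq => d; rewrite -dvdn_divisors ?gcdn_gt0 ?m_gt0 // dvdn_gcd.
case/andP=> dv_m dv_n; have d_gt0 := dvdn_gt0 m_gt0 dv_m.
have [m'_gt0 n'_gt0]: 0 < m %/ d /\ 0 < n %/ d by rewrite !divn_dvd_gt0.
rewrite mul_divn_sqr // -sum_coprime_divisors // !big_distrr /= -[RHS]big_divisors_compl //.
apply: eq_bigr => a _; rewrite big_distrr /= [RHS]big_mkcond -[RHS]big_divisors_compl //.
by apply: eq_bigr => b _; rewrite /F !divnMA muln1.
Qed.

(** * Moebius inversion *)

Lemma mobius_prime_mul p e : prime p -> 0 < e ->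
  mobius (p * e) = if p %| e then 0%R else (- mobius e)%R.
Proof.
move=> p_pr e_gt0; have p_gt0 := prime_gt0 p_pr.
have logE q : logn q (p * e) = logn q p + logn q e by rewrite lognM.
case dv_p: (p %| e); rewrite {1}/mobius.
  rewrite ifN //; apply/allPn; exists p.
    by rewrite mem_primes p_pr muln_gt0 p_gt0 e_gt0 dvdn_mulr.
  by rewrite logE logn_prime // eqxx add1n eqSS -lt0n logn_gt0 mem_primes p_pr e_gt0.
have p_e : p \notin primes e by rewrite mem_primes dv_p !andbF.
have eqp : perm_eq (primes (p * e)) (p :: primes e).
  apply: uniq_perm => [||q]; rewrite /= ?primes_uniq ?p_e //.
  by rewrite primesM // (primes_prime p_pr) !inE.
rewrite (perm_size eqp) (perm_all _ eqp) /= logE logn_prime // eqxx.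
have -> : logn p e = 0 by apply/eqP; rewrite -leqn0 leqNgt logn_gt0.
rewrite /mobius; have -> : all (fun q => logn q (p * e) == 1) (primes e) =
         all (fun q => logn q e == 1) (primes e).
  apply: eq_in_all => q q_e; rewrite logE logn_prime //.
  by case: (q =P p) q_e p_e => // -> ->.
by rewrite addn0 /=; case: ifP => _; rewrite ?GRing.exprS ?GRing.mulN1r ?GRing.oppr0.
Qed.

(** For [n > 1] the terms cancel in pairs [a], [p * a], where [p] is a fixed prime
    divisor of [n] and [p] does not divide [a]; divisors multiple of [p ^ 2]
    contribute zero. *)
Lemma sum_mobius n : 0 < n ->
  (\sum_(d <- divisors n) mobius d = (n == 1)%N%:R)%R.
Proof.
move=> n_gt0; have [->|n_neq1] := eqVneq n 1.
  by rewrite /divisors /= big_seq1.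
have n_gt1: 1 < n by rewrite ltn_neqAle eq_sym n_neq1.
set p := pdiv n; have p_pr: prime p := pdiv_prime n_gt1.
have dv_p: p %| n := pdiv_dvd n; have p_gt0 := prime_gt0 p_pr.
have q_gt0 : 0 < n %/ p by rewrite divn_dvd_gt0.
rewrite (bigID (dvdn p)) /= big_divisors_multiple //.
have -> : (\sum_(a <- divisors (n %/ p)%N) mobius (p * a)%N =
         - \sum_(a <- divisors n | ~~ (p %| a)%N) mobius a)%R.
  rewrite -GRing.sumrN.
  transitivity (\sum_(a <- divisors (n %/ p)%N | ~~ (p %| a)%N) - mobius a)%R.
    rewrite [RHS]big_mkcond; apply: eq_big_seq => a.
    rewrite -dvdn_divisors // => /(dvdn_gt0 q_gt0) a_gt0.
    by rewrite mobius_prime_mul //; case: ifP.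
  rewrite -big_filter -[RHS]big_filter; apply: perm_big.
  apply: uniq_perm => [||a]; rewrite ?filter_uniq ?divisors_uniq //.
  rewrite !mem_filter -!dvdn_divisors //; case pa: (p %| a) => //=.
  rewrite -{2}(divnK dv_p) Gauss_dvdl // coprime_sym prime_coprime //.
  by rewrite pa.
by rewrite GRing.addNr.
Qed.

Lemma sum_dirichlet_mobius (R : GRing.ComNzRing.type) (f : nat -> R) n : 0 < n ->
  (\sum_(d <- divisors n) dirichlet (fun k => (mobius k)%:~R) f d = f n)%R.
Proof.
move=> n_gt0; rewrite /dirichlet.
transitivity (\sum_(d <- divisors n) \sum_(e <- divisors d) (mobius (d %/ e)%N)%:~R * f e)%R.
  apply: eq_big_seq => d; rewrite -dvdn_divisors // => /(dvdn_gt0 n_gt0) d_gt0.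
  rewrite -big_divisors_compl //; apply: eq_big_seq => e.
  by rewrite -dvdn_divisors // => dv_e; rewrite divnA // mulnC mulnK // (dvdn_gt0 d_gt0).
(* After the exchange the coefficient of [f e] is the sum of [mobius] over the
   divisors of [n / e], which vanishes unless [e = n]. *)
rewrite exchange_divisors // (bigD1_seq n) ?divisors_uniq ?divisors_id //=.
have q_gt0 e : e %| n -> 0 < n %/ e by move=> dv_e; rewrite divn_dvd_gt0.
have sumE e : e %| n ->
    (\sum_(k <- divisors (n %/ e)%N) (mobius (e * k %/ e)%N)%:~R * f e = (n == e)%:R * f e)%R.
  move=> dv_e; have e_gt0 := dvdn_gt0 n_gt0 dv_e.
  under eq_bigr do rewrite mulKn //.
  rewrite -GRing.mulr_suml -GRing.rmorph_sum /= sum_mobius ?q_gt0 //.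
  by rewrite -(eqn_pmul2r e_gt0) mul1n divnK // GRing.rmorph_nat.
rewrite sumE // eqxx GRing.mul1r big_seq_cond big1 ?GRing.addr0 // => e /andP[].
rewrite -dvdn_divisors // => dv_e ne; rewrite sumE // eq_sym (negbTE ne).
exact: GRing.mul0r.
Qed.

Lemma sum_gcd_dirichlet_mobius (R : GRing.ComNzRing.type) (f : nat -> R) m n :
  0 < m -> 0 < n ->
  (\sum_(a <- divisors m) \sum_(b <- divisors n) f (gcdn a b) =
   \sum_(d <- divisors (gcdn m n))
      dirichlet (fun k => (mobius k)%:~R) f d
        * (tau (m %/ d)%N)%:R * (tau (n %/ d)%N)%:R)%R.
Proof.
move=> m_gt0 n_gt0; pose D := dirichlet (fun k => (mobius k)%:~R)%R f.
transitivity (\sum_(a <- divisors m) \sum_(b <- divisors n)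
                 \sum_(d <- divisors (gcdn a b)) D d)%R.
  apply: eq_big_seq => a; rewrite -dvdn_divisors // => /(dvdn_gt0 m_gt0) a_gt0.
  by apply: eq_bigr => b _; rewrite sum_dirichlet_mobius // gcdn_gt0 a_gt0.
rewrite (exchange_divisors_common _ (fun d _ _ => D d)) //.
apply: eq_bigr => d _.
rewrite !tau_sum !GRing.natr_sum [X in (X * _)%R]GRing.mulr_sumr GRing.mulr_suml.
by apply: eq_bigr => a _; rewrite GRing.mulr_sumr; apply: eq_bigr => b _; rewrite !GRing.mulr1.
Qed.

(** * Subgroups of cyclic groups and of their products *)

(** Summing a function of the order over a group amounts to summing over its cyclic
    subgroups [H], each counted with its [totient #|H|] generators. *)
Lemma sum_order_cyclic_subgroups (gT : finGroupType) (G : {group gT})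
    (V : nmodType) (F : nat -> V) :
  (\sum_(z in G) F #[z]%g =
   \sum_(H in [set H in subgroups G | cyclic H]) F #|H| *+ totient #|H|)%R.
Proof.
rewrite (partition_big (fun z => <[z]>%G)
           (fun H => H \in [set H in subgroups G | cyclic H])) /=; last first.
  by move=> z Gz; rewrite !inE cycle_subG Gz cycle_cyclic.
apply: eq_bigr => H; rewrite !inE => /andP[sHG /cyclicP[x defH]].
transitivity (\sum_(z in [set z | generator <[x]>%g z]) F #|H|)%R.
  apply: eq_big => [z|z /andP[_ /eqP <-] //].
  rewrite !inE -val_eqE /= defH /generator [RHS]eq_sym andb_idl // => /eqP eqH.
  by rewrite -cycle_subG eqH -defH.
by rewrite GRing.sumr_const -totient_gen /order defH.
Qed.

(** A cyclic group has exactly one subgroup for each divisor of its order. *)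
Lemma perm_card_subgroups_cyclic (gT : finGroupType) (A : {group gT}) : cyclic A ->
  perm_eq [seq #|H| | H : {group gT} <- enum (subgroups A)] (divisors #|A|).
Proof.
move=> cycA; apply: uniq_perm => [||d]; rewrite ?divisors_uniq //.
  rewrite map_inj_in_uniq ?enum_uniq // => H K; rewrite !mem_enum !inE => sHA sKA eqHK.
  by apply/val_inj/eqP; rewrite /= (eq_subG_cyclic cycA) ?eqHK.
rewrite -dvdn_divisors ?cardG_gt0 //; apply/mapP/idP => [[H]|].
  by rewrite mem_enum inE => sHA ->; apply: cardSg.
case/cyclicP: cycA => x -> dv_d.
have /setP/(_ <[x ^+ (#[x] %/ d)]>%G)%g := cycle_sub_group dv_d.
rewrite !inE eqxx => /andP[sH /eqP cardH].
by exists <[x ^+ (#[x] %/ d)]>%G%g; rewrite ?mem_enum ?inE.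
Qed.

Lemma big_subgroups_cyclic (R : Type) (idx : R) (op : Monoid.com_law idx)
    (gT : finGroupType) (A : {group gT}) (P : pred nat) (F : nat -> R) : cyclic A ->
  \big[op/idx]_(H in subgroups A | P #|H|) F #|H| =
  \big[op/idx]_(d <- divisors #|A| | P d) F d.
Proof.
move=> cycA; rewrite -(perm_big _ (perm_card_subgroups_cyclic cycA)) big_map.
by rewrite big_enum_cond.
Qed.

Lemma card_subgroups_cyclic (gT : finGroupType) (G : {group gT}) : cyclic G ->
  #|subgroups G| = tau #|G|.
Proof.
by move=> cycG; rewrite /tau -(perm_size (perm_card_subgroups_cyclic cycG)) size_map -cardE.
Qed.

Lemma sum_order_cyclic (gT : finGroupType) (A : {group gT}) (V : nmodType)
    (F : nat -> V) : cyclic A ->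
  (\sum_(z in A) F #[z]%g = \sum_(d <- divisors #|A|) F d *+ totient d)%R.
Proof.
move=> cycA; rewrite sum_order_cyclic_subgroups.
rewrite -(big_subgroups_cyclic _ xpredT (fun d => F d *+ totient d)%R cycA).
apply: eq_bigl => H; rewrite !inE andbT andb_idr // => sHA.
exact: cyclicS cycA.
Qed.

Lemma order_pair (gT1 gT2 : finGroupType) (x : gT1) (y : gT2) :
  #[(x, y)]%g = lcmn #[x]%g #[y]%g.
Proof.
have expE k : ((x, y) ^+ k = (x ^+ k, y ^+ k))%g.
  by elim: k => [|k IHk] //; rewrite !expgS IHk.
have dvE k : #[(x, y)]%g %| k = (lcmn #[x]%g #[y]%g %| k).
  by rewrite dvdn_lcm !order_dvdn expE.
by apply/eqP; rewrite eqn_dvd -dvE dvE !dvdnn.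
Qed.

Lemma cyclic_setX (gT1 gT2 : finGroupType) (A : {group gT1}) (B : {group gT2}) :
  cyclic A -> cyclic B -> cyclic (setX A B) = coprime #|A| #|B|.
Proof.
move=> /cyclicP[a defA] /cyclicP[b defB].
apply/idP/idP => [/cyclicP[[x y] defAB]|co].
  have /setXP[Ax By]: (x, y) \in setX A B by rewrite defAB cycle_id.
  have := cardsX A B; rewrite defAB -[#|_|]/#[(x, y)]%g order_pair => lcmE.
  have A_gt0 := cardG_gt0 A; have B_gt0 := cardG_gt0 B.
  have l_gt0: 0 < lcmn #|A| #|B| by rewrite lcmn_gt0 A_gt0.
  (* A generator [(x, y)] has order [lcm(#[x], #[y])], which divides
   [lcm(|A|, |B|)]; as this order is [|A| * |B|], the gcd of [|A|] and [|B|] is 1. *)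
have: lcmn #[x]%g #[y]%g %| lcmn #|A| #|B|.
    rewrite dvdn_lcm (dvdn_trans (order_dvdG Ax)) ?dvdn_lcml //=.
    by rewrite (dvdn_trans (order_dvdG By)) ?dvdn_lcmr.
  move/(dvdn_leq l_gt0); rewrite lcmE -muln_lcm_gcd -{2}[lcmn _ _]muln1 leq_pmul2l //.
  by rewrite /coprime eqn_leq gcdn_gt0 A_gt0 andbT.
apply/cyclicP; exists (a, b); apply/esym/eqP; rewrite eqEcard cycle_subG.
rewrite in_setX {1}defA {1}defB !cycle_id /= cardsX -[#|<[_]>%g|]/#[_]%g order_pair.
by rewrite /order -defA -defB -muln_lcm_gcd (eqnP co) muln1.
Qed.

Section ProductOfCyclicGroups.

Variables (gT1 gT2 : finGroupType) (A : {group gT1}) (B : {group gT2}).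
Hypotheses (cycA : cyclic A) (cycB : cyclic B).

Lemma card_cyclic_subgroups_setX :
  #|[set H in subgroups (setX A B) | cyclic H]| =
  \sum_(a <- divisors #|A|) \sum_(b <- divisors #|B|) totient (gcdn a b).
Proof.
apply/eqP; rewrite -(Num.Theory.eqr_nat rat); apply/eqP.
(* The weight of an element of order [k]; the count is carried out in [rat]. *)
pose F k : rat := (((totient k)%:R)^-1)%R.
have t_neq0 k : 0 < k -> ((totient k)%:R != 0 :> rat)%R.
  by move=> k_gt0; rewrite Num.Theory.pnatr_eq0 -lt0n totient_gt0.
transitivity (\sum_(z in setX A B) F #[z]%g)%R.
  rewrite (sum_order_cyclic_subgroups (setX_group A B)) -GRing.sumr_const.
  by apply: eq_bigr => H _; rewrite -GRing.mulr_natr GRing.mulVf // t_neq0 ?cardG_gt0.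
transitivity (\sum_(x in A) \sum_(y in B) F (lcmn #[x]%g #[y]%g))%R.
  rewrite pair_big; apply: eq_big => [[x y]|[x y] _]; rewrite ?in_setX //.
  by rewrite order_pair.
rewrite (eq_bigr _ (fun x _ => sum_order_cyclic (fun k => F (lcmn #[x]%g k)) cycB)).
rewrite (sum_order_cyclic (fun k =>
  \sum_(b <- divisors #|B|) F (lcmn k b) *+ totient b)%R cycA) GRing.natr_sum.
apply: eq_big_seq => a; rewrite -dvdn_divisors // => /(dvdn_gt0 (cardG_gt0 A)) a_gt0.
rewrite GRing.natr_sum -GRing.sumrMnl.
apply: eq_big_seq => b; rewrite -dvdn_divisors // => /(dvdn_gt0 (cardG_gt0 B)) b_gt0.
have tl_neq0: ((totient (lcmn a b))%:R != 0 :> rat)%R by rewrite t_neq0 // lcmn_gt0 a_gt0.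
apply: (GRing.mulfI tl_neq0); rewrite -GRing.mulrnA -[(F _ *+ _)%R]GRing.mulr_natr GRing.mulrA.
by rewrite GRing.mulfV // GRing.mul1r -GRing.natrM mulnC -totient_gcd_lcm // mulnC.
Qed.

(** [A] and [B] being subgroups, the subproducts of [setX A B] are exactly the
    products of a subgroup of [A] with a subgroup of [B]. *)
Lemma subproducts_imset :
  [set H in subgroups (setX A B) | [exists H1 in subgroups A, exists H2 in subgroups B,
     H == setX H1 H2 :> {set _}]] =
  [set setX_group u.1 u.2 | u in setX (subgroups A) (subgroups B)].
Proof.
apply/setP=> H; rewrite inE; apply/andP/imsetP => [[_]|[[H1 H2]]].
  case/exists_inP=> H1 sH1 /exists_inP[H2 sH2 /eqP defH].
  by exists (H1, H2); [rewrite in_setX sH1 | apply: val_inj].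
rewrite in_setX => /andP[sH1 sH2] ->; split.
  by move: sH1 sH2; rewrite !inE /=; apply: setXS.
by apply/exists_inP; exists H1 => //; apply/exists_inP; exists H2.
Qed.

Lemma setX_group_inj : injective (fun u : {group gT1} * {group gT2} => setX_group u.1 u.2).
Proof.
move=> [H1 H2] [K1 K2] /= [/setP eqHK]; congr pair; apply/val_inj/setP=> x /=.
  by have:= eqHK (x, 1%g); rewrite !in_setX !group1 !andbT.
by have:= eqHK (1%g, x); rewrite !in_setX !group1.
Qed.

Lemma card_subproducts_setX :
  #|[set setX_group u.1 u.2 | u in setX (subgroups A) (subgroups B)]| = tau #|A| * tau #|B|.
Proof. by rewrite (card_imset _ setX_group_inj) cardsX !card_subgroups_cyclic. Qed.

Lemma card_cyclic_subproducts_setX :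
  #|[set H in [set setX_group u.1 u.2 | u in setX (subgroups A) (subgroups B)] | cyclic H]| =
  tau (#|A| * #|B|).
Proof.
pose S := [set u in setX (subgroups A) (subgroups B) | coprime #|u.1| #|u.2|].
have cycE u : u \in setX (subgroups A) (subgroups B) ->
    cyclic (setX u.1 u.2) = coprime #|u.1| #|u.2|.
  case: u => H1 H2; rewrite in_setX !inE => /andP[sH1 sH2].
  by rewrite cyclic_setX ?(cyclicS _ cycA) ?(cyclicS _ cycB).
have ->: [set H in [set setX_group u.1 u.2 | u in setX (subgroups A) (subgroups B)] | cyclic H]
         = [set setX_group u.1 u.2 | u in S].
  apply/setP=> H; rewrite inE; apply/andP/imsetP => [[/imsetP[u su ->]]|[u]] /=.
    by rewrite cycE // => co; exists u; rewrite // inE su.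
  by rewrite inE => /andP[su co] ->; split; [apply/imsetP; exists u | rewrite cycE].
rewrite (card_imset _ setX_group_inj) -sum_coprime_divisors ?cardG_gt0 //.
rewrite -(big_subgroups_cyclic _ xpredT
           (fun a => \sum_(b <- divisors #|B| | coprime a b) 1) cycA).
under eq_bigr do rewrite -(big_subgroups_cyclic _ (coprime _) (fun=> 1) cycB).
rewrite pair_big_dep -sum1_card; apply: eq_bigl => [[H1 H2]].
by rewrite !inE !andbT andbA.
Qed.

End ProductOfCyclicGroups.

Lemma cyclic_Zp m : cyclic (Zp m).
Proof.
rewrite /Zp; case: ltnP => _; last exact: cyclic1.
by rewrite Zp_cycle cycle_cyclic.
Qed.

Theorem theorem5 (m n : nat) (hm : (0 < m)%N) (hn : (0 < n)%N) :
  [/\ #|cyclic_subgroups m n|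
        = (\sum_(a <- divisors m)
            \sum_(b <- divisors n | gcdn (m %/ a) (n %/ b) == 1) gcdn a b)%N,
      #|cyclic_subgroups m n|
        = (\sum_(a <- divisors m) \sum_(b <- divisors n) totient (gcdn a b))%N,
      (#|cyclic_subgroups m n|%:Z
        = \sum_(d <- divisors (gcdn m n))
            dirichlet mobius (fun k => (totient k)%:Z) d
              * (tau (m %/ d)%N)%:Z * (tau (n %/ d)%N)%:Z)%R &
      #|cyclic_subgroups m n|
        = (\sum_(d <- divisors (gcdn m n))
            totient d * tau ((m * n) %/ d ^ 2))%N]
  /\ (#|subproducts m n| = (tau m * tau n)%N
      /\ #|cyclic_subproducts m n| = tau (m * n)%N).
Proof.
have cC : #|cyclic_subgroups m n| =
    \sum_(a <- divisors m) \sum_(b <- divisors n) totient (gcdn a b).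
  have := card_cyclic_subgroups_setX (A := Zp_group m) (B := Zp_group n) (cyclic_Zp m) (cyclic_Zp n).
  by rewrite !card_Zp.
have sp : subproducts m n =
    [set setX_group u.1 u.2 | u in setX (subgroups (Zp m)) (subgroups (Zp n))].
  exact: (subproducts_imset (Zp_group m) (Zp_group n)).
split; last first.
  rewrite /cyclic_subproducts sp.
  have := card_subproducts_setX (cyclic_Zp m) (cyclic_Zp n).
  have := card_cyclic_subproducts_setX (cyclic_Zp m) (cyclic_Zp n).
  by rewrite !card_Zp.
split=> //.
- by rewrite cC sum_coprime_gcd // sum_gcd_totient.
- rewrite cC -natz GRing.natr_sum.
  rewrite (eq_bigr _ (fun a _ => GRing.natr_sum _ _ _ _)).
  rewrite (sum_gcd_dirichlet_mobius (fun k => (totient k)%:R)%R) //.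
  apply: eq_bigr => d _; rewrite !natz /dirichlet; congr (_ * _ * _)%R.
  by apply: eq_bigr => e _; rewrite intz natz.
- by rewrite cC sum_gcd_totient.
Qed.
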